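(* Let $k,\ell,q$ be nonnegative integers with $k\geq 3\ell+3$. Then every $q$-tight $(k,\ell)$-stable graph has at most $(k-3\ell-3)+2^{3(\ell+2q+4)^2}$ vertices.
   Context: All graphs are finite, simple and undirected. $\alpha(G)$ denotes the independence number of $G$, and $G-S$ denotes the subgraph of $G$ induced on $V(G)\setminus S$. For integers $k>\ell\geq 0$, a graph $G$ is $(k,\ell)$-stable if for every $S\subseteq V(G)$ with $|S|=k$ we have $\alpha(G-S)\geq \alpha(G)-\ell$. For an integer $q\geq 0$, a graph $G$ on $n$ vertices is $q$-tight $(k,\ell)$-stable if $G$ is $(k,\ell)$-stable and $\alpha(G)=\left\lfloor \frac{n-k+1}{2}\right\rfloor+\ell-q$. *)

(* Defs.v *)
From HB Require Import structures.
From mathcomp Require Import all_boot all_order all_algebra.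
Set Implicit Arguments.
Unset Strict Implicit.
Unset Printing Implicit Defensive.

Record sgraph := SGraph {
  vertex :> finType;
  edge : rel vertex;
  edge_sym : symmetric edge;
  edge_irrefl : irreflexive edge
}.

Section Graphs.
Variable G : sgraph.

Definition independent (A : {set G}) : bool :=
  [forall x in A, forall y in A, ~~ edge x y].

Definition alpha : nat := \max_(A : {set G} | independent A) #|A|.

Variable S : {set G}.

Definition del_vertex : finType := {x : G | x \notin S}.
Definition del_edge : rel del_vertex := fun x y => edge (val x) (val y).

Lemma del_edge_sym : symmetric del_edge.
Proof. by move=> x y; apply: edge_sym. Qed.

Lemma del_edge_irrefl : irreflexive del_edge.
Proof. by move=> x; apply: edge_irrefl. Qed.

Definition del_vertices : sgraph := SGraph del_edge_sym del_edge_irrefl.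

End Graphs.

(* The subtraction is truncated, which is harmless since alpha is nonnegative.
   When #|G| < k there is no such S and every graph is (k, l)-stable. *)
Definition stable (k l : nat) (G : sgraph) : Prop :=
  forall S : {set G}, #|S| = k -> alpha G - l <= alpha (del_vertices S).

(* Stated in int because #|G| - k + 1 and the right-hand side may be negative;
   divz by 2 is the floor. *)
Definition tight_stable (q k l : nat) (G : sgraph) : Prop :=
  stable k l G /\
  ((alpha G)%:Z =
   ((#|G|%:Z - k%:Z + 1) %/ 2)%Z + l%:Z - q%:Z)%R.

(* Main.v *)
Require Import Defs.
From mathcomp Require Import all_boot all_order all_algebra all_fingroup.
From mathcomp Require Import zify.
Set Implicit Arguments.
Unset Strict Implicit.
Unset Printing Implicit Defensive.
Import GRing.Theory.

(** Only the excess d, for which #|G| <= 2 * alpha G + d, matters.  Discard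
    k - 3l - 3 vertices outside a maximum independent set: alpha is unchanged,
    d = l + 2q + 3, and if G has more vertices than claimed, more than
    2 ^ (3(d+1)^2) of them remain.  The point is that in such a large graph some
    three vertices meet every maximum independent set ([small_transversal]).
    Deleting l + 1 such triples lowers alpha by l + 1, which contradicts
    stability.

    To find a triple, delete edges as long as alpha does not grow.  In the
    resulting alpha-critical graph H every edge xy has a witness: a set of
    alpha + 1 vertices whose only inner edge is xy ([critical_subgraph]).  If a
    vertex v has degree at most 2 in H, its closed neighbourhood is a suitable
    triple, since any independent set avoiding it can be enlarged by v.  It
    remains to bound, in terms of d, an alpha-critical graph all of whose degrees
    on a maximum independent set I are at least 3 ([critical_bound]).  Let C be
    the complement of I.  Then H is a bipartite graph between I and C, plus the
    edges inside C.

    - There are at most d^2 edges inside C ([outer_edges_bound]).  For a generic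
      matrix with the support of the bipartite adjacency, the kernel has
      dimension at most d.  The witness T of an edge xy inside C has one vertex
      too many to be matched into I, so the kernel contains a vector w supported
      on T and nonzero at x and at y.  As the witness of xy contains no other
      edge, the matrix with entries w_f(x_g) w_f(y_g), for edges f and
      g = x_g y_g, is diagonal and invertible, while it factors through the
      tensor square of the kernel.

    - Choose one endpoint of each edge inside C and remove the chosen vertices
      from C: what is left is independent, so by Hall's theorem it has a matching
      into I.  This yields at most 2 ^ (d^2) matchings, and by criticality each
      edge between I and C is forced in one of them.  So every vertex of I has
      three edges, forced in three different matchings p1, p2, p3.  The
      tight sets of a matching p order the vertices of I with an edge forced in p;
      along a path of the symmetric difference of p_a and p_b, the orders of p_a
      and of p_b are opposite.  Two vertices lying on a common path for each of the three pairs of matchings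
      would give three pairwise opposite orders, which is absurd.  As there are
      few paths, I is small ([chain_bound]). *)

(** * Neighbourhoods and Hall's theorem *)

Section Neighbourhoods.
Variable V : finType.
Implicit Types (r : rel V) (X Y Z : {set V}).

Definition nbhd r X : {set V} := [set y | [exists x in X, r x y]].

Lemma nbhdP r X y : reflect (exists2 x, x \in X & r x y) (y \in nbhd r X).
Proof. by rewrite inE; apply: exists_inP. Qed.

Lemma nbhdS r X Y : X \subset Y -> nbhd r X \subset nbhd r Y.
Proof.
by move=> /subsetP sXY; apply/subsetP=> y /nbhdP[x /sXY Yx rxy]; apply/nbhdP; exists x.
Qed.

Lemma nbhdU r X Y : nbhd r (X :|: Y) = nbhd r X :|: nbhd r Y.
Proof.
apply/eqP; rewrite eqEsubset subUset !nbhdS ?subsetUl ?subsetUr // !andbT.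
apply/subsetP=> y /nbhdP[x]; rewrite !inE => /orP[] Xx rxy; apply/orP; [left|right];
  by apply/existsP; exists x; rewrite Xx.
Qed.

Definition hall r X := [forall Z : {set V}, (Z \subset X) ==> (#|Z| <= #|nbhd r Z|)].

Lemma hallP r X :
  reflect (forall Z, Z \subset X -> #|Z| <= #|nbhd r Z|) (hall r X).
Proof. by apply: (iffP forallP) => H Z; move: (H Z); [move/implyP|move=> h; apply/implyP]. Qed.

(** Hall's theorem, after Rado: in a minimal set D of edges satisfying Hall's
    condition every vertex of X has a single edge.  If x had two, deleting either
    one would violate the condition on sets Z1 and Z2 containing x, and counting
    neighbours of the union and of the intersection of Z1 and Z2 rules this out. *)
Theorem hall_matching r X : hall r X ->
  exists f : V -> V, {in X &, injective f} /\ {in X, forall x, r x (f x)}.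
Proof.
move=> hX.
pose rD (D : {set V * V}) : rel V := fun x y => (x, y) \in D.
pose E : {set V * V} := [set p | r p.1 p.2].
have rE x y : rD E x y = r x y by rewrite /rD inE.
have hE : hall (rD E) X.
  apply/hallP=> Z ZX; rewrite (_ : nbhd _ Z = nbhd r Z); first exact: (hallP _ _ hX).
  by apply/setP=> y; rewrite !inE; under eq_existsb do rewrite rE.
case: (@minset_exists _ (fun D => hall (rD D) X) E hE) => D /minsetP[/hallP hD minD] /subsetP sDE.
have uniqD x y1 y2 : x \in X -> (x, y1) \in D -> (x, y2) \in D -> y1 = y2.
  move=> Xx D1 D2; apply/eqP/negPn/negP=> y12.
  have bad y : (x, y) \in D ->
      exists Z : {set V}, [/\ x \in Z, Z \subset X & #|nbhd (rD (D :\ (x, y))) Z| < #|Z|].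
    move=> Dy; have: ~~ hall (rD (D :\ (x, y))) X.
      apply/negP=> h; have := minD _ h (subsetDl _ _) => eqD.
      by move: Dy; rewrite -eqD !inE eqxx.
    rewrite negb_forall => /existsP[Z]; rewrite negb_imply -ltnNge => /andP[ZX lt].
    exists Z; split=> //; apply: contraLR lt => xZ; rewrite -leqNgt.
    apply: leq_trans (hD _ ZX) (subset_leq_card _); apply/subsetP=> z /nbhdP[u Zu Du].
    apply/nbhdP; exists u => //; rewrite /rD !inE; apply/andP; split=> //.
    by apply: contraNneq xZ => -[<-].
  have [Z1 [xZ1 Z1X lt1]] := bad _ D1; have [Z2 [xZ2 Z2X lt2]] := bad _ D2.
  set N1 := nbhd _ Z1 in lt1; set N2 := nbhd _ Z2 in lt2.
  have cap : #|Z1 :&: Z2| <= #|N1 :&: N2|.+1.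
    rewrite (cardsD1 x) inE xZ1 xZ2 add1n ltnS.
    apply: leq_trans (hD _ _) (subset_leq_card _).
      by apply: subset_trans (subsetDl _ _) _; apply: subset_trans (subsetIl _ _) Z1X.
    apply/subsetP=> z /nbhdP[u]; rewrite !inE => /and3P[ux u1 u2] Du.
    by apply/andP; split; apply/existsP; exists u; rewrite ?u1 ?u2 /= /rD !inE xpair_eqE (negPf ux).
  have cup : #|Z1 :|: Z2| <= #|N1 :|: N2|.
    apply: leq_trans (hD _ _) (subset_leq_card _); first by rewrite subUset Z1X.
    apply/subsetP=> z /nbhdP[u Zu]; rewrite /rD => Du.
    have [uxE|ux] := eqVneq u x.
      rewrite uxE in Du; rewrite inE; have [zy1|zy1] := eqVneq z y1.
        apply/orP; right; apply/nbhdP; exists x => //.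
        by rewrite /rD !inE Du andbT zy1 xpair_eqE eqxx.
      apply/orP; left; apply/nbhdP; exists x => //.
      by rewrite /rD !inE Du andbT xpair_eqE (negPf zy1) andbF.
    move: Zu; rewrite !inE => /orP[] Zu; apply/orP; [left|right]; apply/existsP;
      by exists u; rewrite Zu /= /rD !inE xpair_eqE (negPf ux).
  have := cardsUI Z1 Z2; have := cardsUI N1 N2; lia.
have exD x : x \in X -> exists y, (x, y) \in D.
  move=> Xx; have := hD [set x]; rewrite sub1set cards1 => /(_ Xx) /card_gt0P[y].
  by case/nbhdP=> u; rewrite inE => /eqP-> Dxy; exists y.
pose f x := odflt x [pick y | (x, y) \in D].
have fD x : x \in X -> (x, f x) \in D.
  move=> Xx; rewrite /f; case: pickP => [y //|nD].
  by have [y] := exD x Xx; rewrite nD.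
exists f; split; last by move=> x Xx; have := sDE _ (fD x Xx); rewrite inE.
move=> x1 x2 X1 X2 f12.
apply/eqP/negPn/negP=> x12.
have := hD [set x1; x2]; rewrite cards2 x12 [nat_of_bool _]/= subUset !sub1set X1 X2 => /(_ isT).
apply/negP; rewrite -ltnNge ltnS -(cards1 (f x1)); apply/subset_leq_card/subsetP=> y.
case/nbhdP=> u; rewrite !inE => /orP[]/eqP-> Dy.
  by rewrite (uniqD _ _ _ X1 Dy (fD _ X1)).
by rewrite f12 (uniqD _ _ _ X2 Dy (fD _ X2)).
Qed.
End Neighbourhoods.

(** * Forced edges in families of matchings *)

Lemma card_le_fibers (T U : finType) (A : {set T}) (g : T -> U) q :
  (forall u, #|[set x in A | g x == u]| <= q) -> #|A| <= #|U| * q.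
Proof.
move=> hq; rewrite -sum1_card (partition_big g predT) //= -sum_nat_const.
apply: leq_sum => u _; apply: leq_trans (hq u).
by rewrite -sum1_card; apply: eq_leq; apply: eq_bigl => x; rewrite inE.
Qed.

(** The setting is a bipartite graph r between I and sets C p indexed by a finite
    type, each C p being matched into I by f p.  A vertex i of I is linked to j by
    [step p p'] when the edges that f p puts at i and f p' puts at j share their
    other end, so the connected pieces of [step p p'] are the paths and cycles of
    the symmetric difference of the two matchings. *)
Section Chains.
Variables (V P : finType) (r : rel V) (I : {set V}) (C : P -> {set V}) (f : P -> V -> V).
Hypothesis f_inj : forall p, {in C p &, injective (f p)}.
Hypothesis f_rel : forall p c, c \in C p -> r c (f p c).
Hypothesis f_I : forall p c, c \in C p -> f p c \in I.

(** As f p matches Z into its neighbourhood, the inclusion means that Z has exactly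
    as many neighbours as elements: Z is tight in Hall's condition. *)
Definition tight p (Z : {set V}) := (Z \subset C p) && (nbhd r Z \subset f p @: Z).

(** The tight set Z makes the edge ic belong to every matching of C p into I:
    such a matching sends Z onto its neighbours, and c is the only element of Z
    that is adjacent to i. *)
Definition forced p i c := 
  [/\ c \in C p, f p c = i & exists Z, [/\ tight p Z, c \in Z & i \notin nbhd r (Z :\ c)]].

Definition implies p i j := forall Z, tight p Z -> i \in nbhd r Z -> j \in nbhd r Z.

Definition step p p' : rel V :=
  fun i j => [exists c in C p :&: C p', (f p c == i) && (f p' c == j)].

Definition ends p p' := [set t in I | ~~ [exists j, step p p' t j]].

Lemma stepP p p' i j :
  reflect (exists c, [/\ c \in C p, c \in C p', f p c = i & f p' c = j]) (step p p' i j).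
Proof.
apply: (iffP exists_inP) => [[c]|[c [c1 c2 <- <-]]].
  by rewrite inE => /andP[c1 c2] /andP[/eqP <- /eqP <-]; exists c.
by exists c; rewrite ?inE ?c1 ?c2 ?eqxx.
Qed.

(** A matching sends a tight set onto its neighbourhood, so tight sets propagate
    forward along alternating paths for p and backward for p'.  This is why the
    two orders are opposite. *)
Lemma step_implies p p' i j : step p p' i j -> implies p i j /\ implies p' j i.
Proof.
case/stepP=> c [c1 c2 <- <-]; split=> Z /andP[/subsetP ZC /subsetP NZ] /NZ/imsetP[c' c'Z].
  by move/(f_inj c1 (ZC _ c'Z)) => cc'; apply/nbhdP; exists c; rewrite ?cc' // -cc' f_rel.
by move/(f_inj c2 (ZC _ c'Z)) => cc'; apply/nbhdP; exists c; rewrite ?cc' // -cc' f_rel.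
Qed.

Lemma connect_implies p p' i j :
  connect (step p p') i j -> implies p i j /\ implies p' j i.
Proof.
case/connectP=> s; elim: s i => [|k s IH] i /=; first by move=> _ ->; split=> Z.
case/andP=> /step_implies[ik ki] /IH h /h[kj jk].
by split=> Z tZ h'; [apply: kj => //; apply: ik|apply: ki => //; apply: jk].
Qed.

(** Removing c from the set Z that forces ic leaves a tight set, and its
    neighbourhood loses i only: it separates
    i from every other j. *)
Lemma forced_antisym p i j c : forced p i c -> implies p i j -> implies p j i -> i = j.
Proof.
case=> cC fc [Z [tZ cZ iN]] ij ji; apply/eqP/negPn/negP=> i_j.
have /andP[ZC /subsetP NZ] := tZ.
have jZ : j \in nbhd r (Z :\ c).
  have /NZ/imsetP[d dZ jE] : j \in nbhd r Z.
    by apply: ij => //; apply/nbhdP; exists c; rewrite // -fc f_rel.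
  apply/nbhdP; exists d; last by rewrite jE f_rel // (subsetP ZC).
  by rewrite !inE dZ andbT; apply: contraNneq i_j => dc; rewrite jE dc fc.
suff: i \in nbhd r (Z :\ c) by apply/negP.
apply: ji => //.
apply/andP; split; first exact: subset_trans (subsetDl _ _) ZC.
apply/subsetP=> k kN.
have /imsetP[d dZ kE] := NZ k (subsetP (nbhdS r (subsetDl Z [set c])) k kN).
rewrite kE; apply: imset_f; rewrite !inE dZ andbT; apply: contraNneq iN => dc.
by have -> : i = k by rewrite kE dc fc.
Qed.

(** [step p p'] is injective from right to left, so two walks with a common end
    point run together backwards until the shorter one is exhausted. *)
Lemma connect_merge p p' i j t : connect (step p p') i t -> connect (step p p') j t ->
  connect (step p p') i j \/ connect (step p p') j i.
Proof.
case/connectP=> s; elim/last_ind: s t => [|s y IH] t /=.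
  by move=> _ -> ji; right.
rewrite rcons_path last_rcons => /andP[ps sy] ->{t} /connectP[s'].
case/lastP: s' => [|s' y'] /=; first by move=> _ <-; left; apply/connectP; exists (rcons s y);
  rewrite ?rcons_path ?ps ?last_rcons.
rewrite rcons_path last_rcons => /andP[ps' sy'] yy'; rewrite -{}yy' in sy'.
have E : last i s = last j s'.
  have /stepP[c [c1 c2 <- fy]] := sy; have /stepP[c' [c1' c2' <- fy']] := sy'.
  by rewrite (f_inj c2 c2') // fy fy'.
by apply: (IH (last i s)) => //; apply/connectP; exists s'.
Qed.

(** The piece of a vertex with distinct forced edges for p and p' is a path, hence
    has an end.  Otherwise the successor map would permute the vertices reachable
    from i, and i would have a predecessor among them, equivalent to i for p. *)
Lemma forced_end p p' i c c' : forced p i c -> forced p' i c' -> c != c' ->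
  exists2 t, connect (step p p') i t & t \in ends p p'.
Proof.
move=> Fc Fc' cc'.
have iI : i \in I by case: Fc => h <- _; apply: f_I.
have SI x : connect (step p p') i x -> x \in I.
  case/connectP=> s; case/lastP: s => [|s y]; first by move=> _ ->.
  by rewrite rcons_path last_rcons => /andP[_ /stepP[d [_ d2 _ <-]]] ->; apply: f_I.
have [/exists_inP[t it te]|noend] :=
    boolP [exists t in ends p p', connect (step p p') i t]; first by exists t.
pose S := [set x | connect (step p p') i x].
pose succ x := odflt x [pick y | step p p' x y].
have succP x : x \in S -> step p p' x (succ x).
  rewrite inE /succ => ix; case: pickP => //= nx.
  case/negP: noend; apply/exists_inP; exists x => //; rewrite inE SI //=.
  by apply/existsP=> -[y]; rewrite nx.
have: succ @: S = S.
  apply/eqP; rewrite eqEcard; apply/andP; split.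
    apply/subsetP=> _ /imsetP[x xS ->]; have := succP x xS; rewrite !inE in xS * => /connect1.
    exact: connect_trans.
  rewrite card_in_imset // => x y /succP/stepP[d [d1 d2 <- <-]] /succP/stepP[d' [d1' d2' <- <-]].
  by move/(f_inj d2 d2') ->.
move=> succS; have : i \in succ @: S by rewrite succS inE connect0.
case/imsetP=> x xS iE; have := succP x xS; rewrite -iE => xi; rewrite inE in xS.
have [ix _] := connect_implies xS; have [xi' _] := step_implies xi.
have ixE := forced_antisym Fc ix xi'; rewrite -ixE in xi.
have /stepP[d [d1 d2 di di']] := xi; case/negP: cc'; apply/eqP.
case: Fc Fc' => cC fc _ [cC' fc' _].
by rewrite -(f_inj d1 cC) ?di ?fc // (f_inj d2 cC') ?di' ?fc'.
Qed.

(** A vertex of I is determined by its three matchings and by the ends of the three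
    paths it lies on: for two vertices sharing all of them, each pair of matchings
    orders the two vertices in opposite ways, and there are only two orders. *)
Theorem chain_bound q :
  (forall p p', #|ends p p'| <= q) ->
  (forall i, i \in I -> exists c1 c2 c3 : V, exists p1 p2 p3 : P,
     [/\ uniq [:: c1; c2; c3], forced p1 i c1, forced p2 i c2 & forced p3 i c3]) ->
  #|I| <= #|P| ^ 3 * q ^ 3.
Proof.
move=> hq hI.
have [->|[i0 i0I]] := set_0Vmem I; first by rewrite cards0.
have [_ [_ [_ [p0 _]]]] := hI i0 i0I.
pose label i (L : (P * P * P) * (V * V * V)) :=
  let: (p1, p2, p3, (t1, t2, t3)) := L in
  [/\ (exists c, forced p1 i c), (exists c, forced p2 i c), (exists c, forced p3 i c)
    & [/\ connect (step p1 p2) i t1, connect (step p1 p3) i t2 & connect (step p2 p3) i t3]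
      /\ [/\ t1 \in ends p1 p2, t2 \in ends p1 p3 & t3 \in ends p2 p3]].
have /fin_all_exists[L hL] : forall i, exists L, i \in I -> label i L.
  move=> i; have [iI|_] := boolP (i \in I); last by exists (p0, p0, p0, (i, i, i)).
  have [c1 [c2 [c3 [p1 [p2 [p3 [+ F1 F2 F3]]]]]]] := hI i iI.
  rewrite /= !inE negb_or andbT => /andP[/andP[c12 c13] c23].
  have [t1 ? ?] := forced_end F1 F2 c12; have [t2 ? ?] := forced_end F1 F3 c13.
  have [t3 ? ?] := forced_end F2 F3 c23.
  by exists (p1, p2, p3, (t1, t2, t3)) => _; split=> //; [exists c1|exists c2|exists c3].
have L_inj i j M : label i M -> label j M -> i = j.
  case: M => -[[p1 p2] p3] [[t1 t2] t3].
  move=> [[c1 F1] [c2 F2] [c3 F3] [[i1 i2 i3] _]] [_ _ _ [[j1 j2 j3] _]].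
  have A1 := forced_antisym F1; have A2 := forced_antisym F2; have A3 := forced_antisym F3.
  have [/connect_implies[]|/connect_implies[]] := connect_merge i1 j1;
  have [/connect_implies[]|/connect_implies[]] := connect_merge i2 j2;
  have [/connect_implies[]|/connect_implies[]] := connect_merge i3 j3; by auto.
have cP : #|{: P * P * P}| = #|P| ^ 3 by rewrite !card_prod !expnS expn0; lia.
rewrite -cP; apply: (card_le_fibers (g := fun i => (L i).1)) => -[[p1 p2] p3].
set A := [set i in I | _].
have LA i : i \in A -> label i (p1, p2, p3, (L i).2).
  by rewrite inE => /andP[/hL]; case: (L i) => M t h /eqP <-.
have inj2 : {in A &, injective (fun i => (L i).2)}.
  by move=> i j /LA hi /LA hj /= E; rewrite E in hi; apply: L_inj hi hj.
rewrite -(card_in_imset inj2) !expnS expn0 muln1 mulnA.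
apply: leq_trans (_ : #|setX (setX (ends p1 p2) (ends p1 p3)) (ends p2 p3)| <= _).
  apply/subset_leq_card/subsetP=> _ /imsetP[i /LA + ->]; case: (L i).2 => -[t1 t2] t3.
  by case=> _ _ _ [_ [h1 h2 h3]]; rewrite !inE in h1 h2 h3 *; rewrite h1 h2 h3.
by rewrite !cardsX !leq_mul.
Qed.
End Chains.

(** * Generic matrices *)

Section Generic.

Lemma sum_pow2_inj N (b c : 'I_N -> bool) :
  \sum_(i < N) b i * 2 ^ i = \sum_(i < N) c i * 2 ^ i -> b =1 c.
Proof.
elim: N b c => [|N IH] b c; first by move=> _ [].
rewrite !big_ord_recl !expn0 !muln1.
have E (d : 'I_N.+1 -> bool) :
    \sum_(i < N) d (lift ord0 i) * 2 ^ lift ord0 i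
    = (\sum_(i < N) d (lift ord0 i) * 2 ^ i).*2.
  by rewrite -muln2 big_distrl /=; apply: eq_bigr => i _; rewrite expnS; lia.
rewrite !E => eq.
have eq0 : b ord0 = c ord0.
  by have := congr1 odd eq; rewrite !oddD !odd_double !addbF !oddb.
have /IH eqS : \sum_(i < N) b (lift ord0 i) * 2 ^ i = \sum_(i < N) c (lift ord0 i) * 2 ^ i.
  by move: eq; rewrite eq0 => /addnI/double_inj.
by move=> i; case: (unliftP ord0 i) => [j|] ->; [apply: eqS | apply: eq0].
Qed.

Lemma sum_pow2_set_inj N (S T : {set 'I_N}) :
  \sum_(i in S) 2 ^ i = \sum_(i in T) 2 ^ i -> S = T.
Proof.
have E (U : {set 'I_N}) : \sum_(i < N) (i \in U) * 2 ^ i = \sum_(i in U) 2 ^ i.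
  by rewrite [RHS]big_mkcond; apply: eq_bigr => i _; rewrite mulnbl.
by rewrite -!E => /sum_pow2_inj eqST; apply/setP.
Qed.

Variables (n : nat) (r : rel 'I_n).
Local Open Scope ring_scope.

Definition weight (x y : 'I_n) : 'I_(#|{: 'I_n * 'I_n}|) := enum_rank (x, y).

(** The exponents are distinct powers of 2, hence different permutations contribute
    different monomials to a minor and nothing cancels. *)
Definition genpoly_mx : 'M[{poly rat}]_n :=
  \matrix_(i, j) if r i j then 'X^(2 ^ weight i j) else 0.

(** The identity is the only permutation contributing the monomial of its own
    degree [ex 1]. *)
Lemma det_genpoly k (ro co : 'I_k -> 'I_n) :
  injective ro -> injective co -> (forall a, r (ro a) (co a)) ->
  \det (mxsub ro co genpoly_mx) != 0.
Proof.
move=> iro ico rc.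
pose ex (s : 'S_k) := (\sum_a 2 ^ weight (ro a) (co (s a)))%N.
have exE s : ex s = (\sum_(i in [set weight (ro a) (co (s a)) | a : 'I_k]) 2 ^ i)%N.
  by rewrite big_imset //= => a b _ _ /enum_rank_inj[/iro].
have exI s : ex s = ex 1%g -> s = 1%g.
  rewrite !exE => /sum_pow2_set_inj eq; apply/permP=> a; rewrite perm1.
  have: weight (ro a) (co (s a)) \in [set weight (ro b) (co ((1%g : 'S_k) b)) | b : 'I_k].
    by rewrite -eq; apply/imsetP; exists a.
  by case/imsetP=> b _ /enum_rank_inj[/iro-> /ico]; rewrite perm1.
apply/eqP=> /(congr1 (fun p : {poly rat} => p`_(ex 1%g))); rewrite coef0 /determinant coef_sum.
have mono (s : 'S_k) : (forall a, r (ro a) (co (s a))) ->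
    \prod_a mxsub ro co genpoly_mx a (s a) = 'X^(ex s).
  by move=> h; rewrite /ex expr_sum; apply: eq_bigr => a _; rewrite !mxE h.
rewrite (bigD1 1%g) //= addrC big1 ?add0r => [|s s1].
  rewrite odd_perm1 expr0 mul1r (mono 1%g); last by move=> a; rewrite perm1.
  by rewrite coefXn eqxx => /eqP; rewrite oner_eq0.
have [/forallP h|] := boolP [forall a, r (ro a) (co (s a))].
  rewrite mono // mulr_sign.
  by case: ifP; rewrite ?coefN coefXn; case: eqP => [/esym/exI sE|]; rewrite ?oppr0 // sE eqxx in s1.
rewrite negb_forall => /existsP[a /negPf na].
by rewrite (bigD1 a) //= !mxE na mul0r mulr0 coef0.
Qed.

Local Notation K := {fraction {poly rat}}.
Definition generic_mx : 'M[K]_n := map_mx (@tofrac _) genpoly_mx.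

Lemma generic_mx0 x y : ~~ r x y -> generic_mx x y = 0.
Proof. by move=> /negPf rxy; rewrite !mxE rxy rmorph0. Qed.

Lemma generic_row_free k (ro co : 'I_k -> 'I_n) :
  injective ro -> injective co -> (forall a, r (ro a) (co a)) ->
  row_free (rowsub ro generic_mx).
Proof.
move=> iro ico rc; rewrite -row_leq_rank.
have : \rank (mxsub ro co generic_mx) = k.
  apply: mxrank_unit; rewrite unitmxE unitfE /generic_mx -map_mxsub det_map_mx tofrac_eq0.
  exact: det_genpoly.
move=> rk; rewrite -{1}rk.
rewrite (_ : mxsub ro co _ = rowsub ro generic_mx *m colsub co 1%:M) ?mxrankM_maxl //.
apply/matrixP=> a b; rewrite !mxE (bigD1 (co b)) //= !mxE eqxx mulr1 big1 ?addr0 // => j jb.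
by rewrite !mxE (negPf jb) mulr0.
Qed.
End Generic.

(** * Deficient sets and kernel vectors *)

Section GenericAdjacency.
Variables (V : finType) (r : rel V).
Local Open Scope ring_scope.

Definition rows (Z : {set V}) (a : 'I_#|Z|) : 'I_#|V| := enum_rank (enum_val a).

Lemma rows_inj Z : injective (@rows Z).
Proof. by move=> a b /enum_rank_inj/enum_val_inj. Qed.

(** Matchings are turned into linear independence.  The field is hidden behind the
    existential because terms over an abstract field cannot be unfolded by
    computation. *)
Lemma generic_adjacency : exists (K : fieldType) (Q : 'M[K]_#|V|),
  (forall i j, ~~ r (enum_val i) (enum_val j) -> Q i j = 0)
  /\ (forall Z, hall r Z -> row_free (rowsub (@rows Z) Q)).
Proof.
pose r' : rel 'I_#|V| := fun i j => r (enum_val i) (enum_val j).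
exists {fraction {poly rat}}, (generic_mx r'); split=> [i j|Z]; first exact: generic_mx0.
case/hall_matching=> f [fI rf].
apply: (generic_row_free (co := fun a => enum_rank (f (enum_val a)))).
- exact: rows_inj.
- by move=> a b /enum_rank_inj/fI E; apply/enum_val_inj/E; apply: enum_valP.
by move=> a; rewrite /r' !enum_rankK; apply/rf/enum_valP.
Qed.

End GenericAdjacency.

Section PairBound.
Variables (V : finType) (r : rel V) (K : fieldType).
Local Open Scope ring_scope.
Local Notation n := #|V|.
Variable Q : 'M[K]_n.
Hypothesis Q0 : forall i j, ~~ r (enum_val i) (enum_val j) -> Q i j = 0.
Hypothesis hall_row_free : forall Z, hall r Z -> row_free (rowsub (@rows V Z) Q).

Definition supported (Z : {set V}) (w : 'rV[K]_n) :=
  forall x, x \notin Z -> w 0 (enum_rank x) = 0.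

Lemma supported_rows Z w : supported Z w ->
  w = colsub (@rows V Z) w *m rowsub (@rows V Z) 1%:M.
Proof.
move=> sw; apply/rowP=> j; rewrite !mxE -(enum_valK j).
have [jZ|jZ] := boolP (enum_val j \in Z).
  rewrite (bigD1 (enum_rank_in jZ (enum_val j))) //= !mxE /rows enum_rankK_in //.
  rewrite eqxx mulr1 big1 ?addr0 // => a aj; rewrite !mxE /rows (inj_eq enum_rank_inj).
  case: eqP => [E|]; last by rewrite mulr0.
  by case/eqP: aj; apply: enum_val_inj; rewrite enum_rankK_in.
rewrite sw // big1 // => a _; rewrite !mxE /rows (inj_eq enum_rank_inj).
by case: eqP => [E|]; rewrite ?mulr0 //; case/negP: jZ; rewrite -E enum_valP.
Qed.

Lemma hall_kernel Z w : hall r Z -> supported Z w -> w *m Q = 0 -> w = 0.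
Proof.
move=> hZ sw; rewrite (supported_rows sw) -mulmxA mul_rowsub_mx mul1mx => /eqP.
by rewrite mulmx_free_eq0 ?hall_row_free // => /eqP->; rewrite mul0mx.
Qed.

Lemma hall_kernel_dim Z : hall r Z -> (\rank (kermx Q) <= n - #|Z|)%N.
Proof.
move=> /hall_row_free; rewrite -row_leq_rank => h.
rewrite mxrank_ker leq_sub2l //; apply: leq_trans h _.
by rewrite -{1}(mul1mx Q) -mul_rowsub_mx mxrankM_maxr.
Qed.

(** The rows of Q indexed by Z vanish outside the neighbourhood of Z, which has
    fewer columns than Z has rows. *)
Lemma deficient_kernel Z : (#|nbhd r Z| < #|Z|)%N ->
  exists w, [/\ supported Z w, w *m Q = 0 & w != 0].
Proof.
move=> lt; set R := rowsub (@rows V Z) Q.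
have rkR : (\rank R < #|Z|)%N.
  apply: leq_ltn_trans lt.
  rewrite (_ : R = colsub (@rows V (nbhd r Z)) R *m rowsub (@rows V (nbhd r Z)) 1%:M).
    by rewrite mulmx_max_rank.
  apply/row_matrixP=> a; rewrite row_mul.
  rewrite (_ : row a (colsub _ R) = colsub (@rows V (nbhd r Z)) (row a R)); last first.
    by apply/rowP=> j; rewrite !mxE.
  apply: supported_rows => x xN.
  rewrite !mxE Q0 // !enum_rankK; apply: contra xN => rx.
  by apply/nbhdP; exists (enum_val a) => //; apply: enum_valP.
have kn0 : kermx R != 0 by rewrite -mxrank_eq0 mxrank_ker subn_eq0 -ltnNge.
pose u := nz_row (kermx R).
have uR : u *m R = 0 by apply/sub_kermxP/nz_row_sub.
exists (u *m rowsub (@rows V Z) 1%:M); split.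
- move=> x xZ; rewrite mxE big1 // => a _; rewrite !mxE /rows (inj_eq enum_rank_inj).
  by case: eqP => [E|]; rewrite ?mulr0 //; case/negP: xZ; rewrite -E enum_valP.
- by rewrite -mulmxA mul_rowsub_mx mul1mx.
rewrite mulmx_free_eq0 ?nz_row_eq0 //; apply/row_freeP.
exists (colsub (@rows V Z) 1%:M); apply/matrixP=> a b; rewrite !mxE.
rewrite (bigD1 (rows a)) //= !mxE eqxx mul1r (inj_eq (@rows_inj V Z)) big1 ?addr0 // => j ja.
by rewrite !mxE eq_sym (negPf ja) mul0r.
Qed.

(** Each pair f has a kernel vector w f supported on T f.  Its two coordinates at f
    are nonzero, since otherwise w f would be supported on a set whose rows are
    independent.  The matrix D of the products of the two coordinates of w f at g is
    then diagonal with nonzero diagonal, so its rank is the number of pairs; but it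
    is a product through the tensor square of the kernel of Q. *)
Lemma pair_bound_generic (Z0 : {set V}) (F : {set V * V}) (T : V * V -> {set V}) :
  hall r Z0 ->
  (forall f, f \in F -> [/\ hall r (T f :\ f.1), hall r (T f :\ f.2)
                          & (#|nbhd r (T f)| < #|T f|)%N]) ->
  (forall f g, f \in F -> g \in F -> (g.1 \in T f) && (g.2 \in T f) -> g = f) ->
  (#|F| <= (n - #|Z0|) ^ 2)%N.
Proof.
move=> hZ0 hF sep.
have /fin_all_exists[w hw] : forall f, exists w : 'rV[K]_n, f \in F ->
    [/\ w *m Q = 0, supported (T f) w, w 0 (enum_rank f.1) != 0 & w 0 (enum_rank f.2) != 0].
  move=> f; have [fF|_] := boolP (f \in F); last by exists 0.
  have [h1 h2 /deficient_kernel[w [sw wQ w0]]] := hF f fF.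
  have nz x : hall r (T f :\ x) -> w 0 (enum_rank x) != 0.
    move=> hx; apply: contraNneq w0 => wx; apply/eqP; apply: (hall_kernel hx) => // y.
    by rewrite !inE negb_and negbK => /orP[/eqP->|/sw].
  by exists w => _; split=> //; apply: nz.
pose N := row_base (kermx Q); set k := \rank (kermx Q) in N.
have le_k : (k <= n - #|Z0|)%N by apply: hall_kernel_dim.
pose el i : V * V := enum_val (i : 'I_#|F|).
have elF i : el i \in F by apply: enum_valP.
pose la i := w (el i) *m pinvmx N.
have laN i : la i *m N = w (el i).
  apply: mulmxKpV; rewrite eq_row_base; apply/sub_kermxP.
  by have [] := hw _ (elF i).
pose L : 'M[K]_(#|F|, k * k) := \matrix_i mxvec ((la i)^T *m la i).
pose P : 'M[K]_(#|F|, k * k) :=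
  \matrix_j mxvec (col (enum_rank (el j).1) N *m (col (enum_rank (el j).2) N)^T).
pose D := L *m P^T.
have DE i j : D i j = w (el i) 0 (enum_rank (el j).1) * w (el i) 0 (enum_rank (el j).2).
  rewrite -laN !mxE (reindex _ (curry_mxvec_bij _ _)) /= big_distrl /=.
  under [RHS]eq_bigr do rewrite big_distrr /=.
  rewrite pair_bigA /=; apply: eq_bigr => -[a b] _ /=.
  rewrite !mxE !mxvecE !mxE !big_ord1 !mxE.
  by rewrite mulrACA.
have: \rank D = #|F|.
  apply: mxrank_unit; rewrite unitmxE unitfE (_ : D = diag_mx (\row_i D i i)).
    rewrite det_diag; apply/prodf_neq0 => i _; rewrite mxE DE.
    by have [_ _ w1 w2] := hw _ (elF i); rewrite mulf_neq0.
  apply/matrixP=> i j; rewrite [RHS]mxE [X in X *+ _]mxE; have [->|ij] := eqVneq; first by rewrite mulr1n.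
  rewrite mulr0n DE; apply/eqP; rewrite mulf_eq0; apply/negPn; rewrite negb_or.
  have [_ sw _ _] := hw _ (elF i).
  apply/negP=> /andP[w1 w2]; case/eqP: ij; apply: enum_val_inj; apply/esym/sep => //.
  by apply/andP; split; [move: w1|move: w2]; apply: contraR => /sw ->.
move=> <-; apply: leq_trans (mulmx_max_rank _ _) _.
by rewrite -mulnn leq_mul.
Qed.
End PairBound.

Theorem pair_bound (V : finType) (r : rel V) (Z0 : {set V})
    (F : {set V * V}) (T : V * V -> {set V}) :
  hall r Z0 ->
  (forall f, f \in F -> [/\ hall r (T f :\ f.1), hall r (T f :\ f.2)
                          & #|nbhd r (T f)| < #|T f|]) ->
  (forall f g, f \in F -> g \in F -> (g.1 \in T f) && (g.2 \in T f) -> g = f) ->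
  #|F| <= (#|V| - #|Z0|) ^ 2.
Proof.
by have [K [Q [Q0 Qfree]]] := generic_adjacency r; apply: (pair_bound_generic Q0 Qfree).
Qed.

(** * Alpha-critical graphs *)

Lemma card_disjointU (V : finType) (X Y : {set V}) :
  [disjoint X & Y] -> #|X :|: Y| = #|X| + #|Y|.
Proof. by move=> dXY; apply/eqP; rewrite (leq_card_setU X Y).2. Qed.

Lemma hall_union (V : finType) (r : rel V) (X Y : {set V}) :
  hall r X -> hall r Y -> [disjoint nbhd r X & nbhd r Y] -> hall r (X :|: Y).
Proof.
move=> /hallP hX /hallP hY dXY; apply/hallP=> Z ZXY.
have ZY : Z :\: X \subset Y by rewrite subDset.
rewrite -(cardsID X Z) -{3}(setID Z X) nbhdU.
have := hX _ (subsetIr Z X); have := hY _ ZY.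
have : [disjoint nbhd r (Z :&: X) & nbhd r (Z :\: X)].
  by apply: disjointW dXY; apply: nbhdS => //; apply: subsetIr.
by move/card_disjointU=> -> ? ?; lia.
Qed.

Section Critical.
Variables (V : finType) (e : rel V).
Hypothesis e_sym : symmetric e.
Hypothesis e_irr : irreflexive e.

Definition indep (B : {set V}) : bool := [forall x in B, forall y in B, ~~ e x y].

Lemma indepP (B : {set V}) : reflect {in B &, forall x y, ~~ e x y} (indep B).
Proof.
apply: (iffP forall_inP) => h x; first by move=> y xB; move/forall_inP: (h x xB); apply.
by move=> xB; apply/forall_inP=> y; apply: h.
Qed.

Lemma indepS (B D : {set V}) : B \subset D -> indep D -> indep B.
Proof. by move/subsetP=> BD /indepP iD; apply/indepP=> x y /BD xD /BD; apply: iD. Qed.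

Definition max_indep (A I : {set V}) :=
  [/\ I \subset A, indep I & forall J : {set V}, J \subset A -> indep J -> #|J| <= #|I|].

(** Removing the edge xy makes J independent; for J larger than every independent
    set, such a J witnesses that xy is critical. *)
Definition near_indep (A : {set V}) x y (J : {set V}) :=
  [/\ J \subset A, x \in J, y \in J &
      {in J &, forall u v, e u v -> (u, v) = (x, y) \/ (u, v) = (y, x)}].

Variables A I : {set V}.
Hypothesis maxI : max_indep A I.
Hypothesis crit : forall x y, e x y -> exists2 J, near_indep A x y J & #|I| < #|J|.

Let C := A :\: I.
(** The bipartite graph between I and C, with loops added outside A: the loops make
    the vertices outside A contribute nothing to the kernel of the generic matrix. *)
Definition cross : rel V := fun x y =>
  e x y && ((x \in C) && (y \in I) || (x \in I) && (y \in C)) || (x == y) && (x \notin A).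

Lemma sub_I : I \subset A. Proof. by case: maxI. Qed.
Lemma sub_C : C \subset A. Proof. exact: subsetDl. Qed.
Lemma notin_I x : x \in C -> x \in I = false. Proof. by rewrite inE => /andP[/negPf]. Qed.

Lemma edge_I x y : x \in I -> e x y -> y \in C.
Proof.
move=> xI exy; have [J [/subsetP JA _ /JA yA _] _] := crit exy; rewrite inE yA andbT.
by apply: contraL exy => yI; have [_ /indepP iI _] := maxI; apply: iI.
Qed.

Lemma crossC x y : x \in C -> cross x y = (y \in I) && e x y.
Proof.
move=> xC; rewrite /cross xC (notin_I xC) (subsetP sub_C _ xC) andbF orbF /=.
by rewrite orbF andbC.
Qed.

Lemma crossI x y : x \in I -> cross x y = e x y.
Proof.
move=> xI; have xC : x \in C = false by rewrite inE xI.
rewrite /cross xI xC (subsetP sub_I _ xI) andbF orbF /=.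
by case exy: (e x y) => //=; apply: edge_I exy.
Qed.

Lemma cross_sym : symmetric cross.
Proof.
move=> x y; rewrite /cross e_sym orbC [in RHS]orbC; congr (_ || _ && _); last first.
  by rewrite orbC; congr (_ || _); rewrite andbC.
by rewrite eq_sym; case: eqP => //= ->.
Qed.

Lemma nbhd_crossC (Z : {set V}) : Z \subset C -> nbhd cross Z \subset I.
Proof.
by move/subsetP=> ZC; apply/subsetP=> y /nbhdP[x /ZC xC]; rewrite crossC // => /andP[].
Qed.

(** If X had fewer neighbours in I than elements, exchanging them for X would
    enlarge I. *)
Lemma hall_indep (Z : {set V}) : Z \subset C -> indep Z -> hall cross Z.
Proof.
move=> ZC iZ; apply/hallP=> X XZ; have XC := subset_trans XZ ZC.
have iX := indepS XZ iZ; have NI := nbhd_crossC XC.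
have [_ /indepP iI maxJ] := maxI.
have: #|X :|: (I :\: nbhd cross X)| <= #|I|.
  apply: maxJ; first by rewrite subUset (subset_trans XC sub_C) (subset_trans (subsetDl _ _) sub_I).
  have no x y : x \in X -> y \in I -> y \notin nbhd cross X -> ~~ e x y.
    move=> xX yI; apply: contra => exy; apply/nbhdP; exists x => //.
    by rewrite crossC ?(subsetP XC) // yI.
  apply/indepP=> x y; rewrite !inE => /orP[xX|/andP[xN xI]] /orP[yX|/andP[yN yI]].
  - by move/indepP: iX; apply.
  - by apply: no => //; rewrite inE.
  - by rewrite e_sym; apply: no => //; rewrite inE.
  - exact: iI.
have := cardsID (nbhd cross X) I; rewrite (setIidPr NI).
have : [disjoint X & I :\: nbhd cross X].
  rewrite -setI_eq0; apply/eqP/setP=> x; rewrite !inE.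
  by case xX: (x \in X) => //=; rewrite (notin_I (subsetP XC _ xX)) andbF.
by move/card_disjointU; lia.
Qed.

(** Inside I, of size less than #|J|, the elements of J and the neighbours of the
    rest Z of J can only overlap in J :&: nbhd cross Z. *)
Lemma near_indep_nbhd x y J : near_indep A x y J -> #|I| < #|J| ->
  #|nbhd cross (J :&: C)| < #|J :&: C| + #|J :&: nbhd cross (J :&: C)|.
Proof.
move=> [JA _ _ _] ltJ; set N := nbhd _ _.
have NI : N \subset I by apply: nbhd_crossC; apply: subsetIr.
have : #|(J :&: I) :|: N| <= #|I| by rewrite subset_leq_card // subUset subsetIr.
have := cardsUI (J :&: I) N; rewrite -setIA (setIidPr NI).
have : #|J| = #|J :&: I| + #|J :&: C|.
  rewrite -(cardsID I J); congr (_ + #|pred_of_set _|); apply/setP=> z; rewrite !inE.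
  by case zJ: (z \in J); rewrite ?andbF //= (subsetP JA _ zJ) andbT.
lia.
Qed.

Hypothesis no_isolated : forall x, x \in I -> exists y, e x y.

(** Take a minimal X with fewer neighbours than elements, an edge xy with x in X, and
    its witness J.  Exchanging N(X) for X in J shows that X :&: J is again
    deficient, so X is contained in J by minimality.  Minimality also gives
    N(X \ x) = N(X), so y has another neighbour in X, hence a second edge in J. *)
Lemma hall_I : hall cross I.
Proof.
apply/negPn/negP=> nh.
pose bad (X : {set V}) := (X \subset I) && (#|nbhd cross X| < #|X|).
have [X0 badX0] : exists X, bad X.
  move: nh; rewrite negb_forall => /existsP[X]; rewrite negb_imply -ltnNge => h.
  by exists X.
have [X /minsetP[/andP[XI ltX] minX] _] := minset_exists badX0.
have /card_gt0P[x xX] : 0 < #|X| by apply: leq_ltn_trans ltX.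
have xI := subsetP XI x xX.
have [y exy] := no_isolated xI; have yC := edge_I xI exy.
have [J nJ ltJ] := crit exy; have [JA xJ yJ eJ] := nJ.
set N := nbhd cross X in ltX.
have NC : N \subset C.
  by apply/subsetP=> z /nbhdP[u /(subsetP XI) uI]; rewrite crossI // => /edge_I; apply.
have eJy u z : u \in I -> u \in J -> z \in J -> e u z -> z = y.
  move=> uI uJ zJ /(eJ u z uJ zJ) [[_ //]|[uy _]].
  by rewrite uy (notin_I yC) in uI.
have XJ : X \subset J.
  have le1 : #|(J :\: N) :|: X| <= #|I|.
    have [_ /indepP iI maxJ] := maxI; apply: maxJ.
      by rewrite subUset (subset_trans (subsetDl _ _) JA) (subset_trans XI sub_I).
    have no u v : u \in X -> v \notin N -> ~~ e u v.
      move=> uX; apply: contra => euv; apply/nbhdP; exists u => //.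
      by rewrite crossI // (subsetP XI).
    apply/indepP=> u v; rewrite in_setU in_setD.
    have [uX _|uX] := boolP (u \in X).
      rewrite in_setU in_setD => /orP[/andP[vN _]|vX]; first exact: no.
      by apply: iI; apply: (subsetP XI).
    rewrite orbF => /andP[uN uJ]; rewrite in_setU in_setD => /orP[/andP[vN vJ]|vX].
      apply/negP=> euv; have yN : y \in N by apply/nbhdP; exists x => //; rewrite crossI.
      by case: (eJ u v uJ vJ euv) => -[uE vE]; [rewrite vE yN in vN|rewrite uE yN in uN].
    by rewrite e_sym; apply: no.
  have badXJ : bad (X :&: J).
    rewrite /bad (subset_trans (subsetIl _ _) XI) /=.
    have : #|nbhd cross (X :&: J)| <= #|y |: (N :\: J)|.
      apply/subset_leq_card/subsetP=> z /nbhdP[u]; rewrite !inE => /andP[uX uJ] ruz.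
      have [zJ|zJ] := boolP (z \in J) => /=.
        rewrite orbF; apply/eqP; apply: (eJy u) => //; first exact: (subsetP XI).
        by rewrite -crossI // (subsetP XI).
      by apply/orP; right; apply/existsP; exists u; rewrite uX.
    have : #|y |: (N :\: J)| <= #|N :\: J|.+1 by rewrite cardsU1; case: (_ \notin _).
    have := cardsID J X; have := cardsID J N; have := cardsID N J; rewrite [J :&: N]setIC.
    have : #|(J :\: N) :|: X| = #|J :\: N| + #|X :\: J|.
      rewrite -(cardsID (J :\: N) (_ :|: _)) setUK; congr (_ + #|pred_of_set _|).
      apply/setP=> z; rewrite !(in_setD, in_setU); case zX: (z \in X); rewrite ?andbF ?orbF ?andNb //.
      have -> : z \in N = false; last by case: (z \in J).
      by apply/negP=> /(subsetP NC); apply/negP; rewrite inE (subsetP XI _ zX).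
    lia.
  by rewrite -(minX _ badXJ (subsetIl _ _)) subsetIr.
have : N \subset nbhd cross (X :\ x).
  suff <- : nbhd cross (X :\ x) = N by [].
  apply/eqP; rewrite eqEcard (nbhdS cross (subsetDl _ _)) /=.
  have: ~~ bad (X :\ x).
    by apply/negP=> b; have := minX _ b (subsetDl _ _) => E; move: xX; rewrite -E !inE eqxx.
  rewrite /bad (subset_trans (subsetDl _ _) XI) -leqNgt /=; apply: leq_trans.
  by rewrite -ltnS (leq_trans ltX) // (cardsD1 x X) xX.
move=> sN; have yN : y \in N by apply/nbhdP; exists x; rewrite ?crossI.
have /nbhdP[u] := subsetP sN y yN.
rewrite in_setD1 => /andP[ux uX]; rewrite crossI ?(subsetP XI) // => euy.
case: (eJ u y (subsetP XJ _ uX) yJ euy) => [[uE]|[uE _]]; first by rewrite uE eqxx in ux.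
by move: (subsetP XI _ uX); rewrite uE (notin_I yC).
Qed.

(** The comparison of ranks selects one orientation of each edge. *)
Definition outer_edges : {set V * V} :=
  [set p | [&& p.1 \in C, p.2 \in C, e p.1 p.2 & enum_rank p.1 < enum_rank p.2]].

(** Taking I, its matching partners in C and the complement of A bounds the kernel
    of the generic matrix of [cross] by the excess of A over twice I. *)
Lemma hall_double : exists2 Z, hall cross Z & #|V| - #|Z| = #|A| - 2 * #|I| /\ 2 * #|I| <= #|A|.
Proof.
have [mu [mu_inj mu_r]] := hall_matching hall_I.
have muC i : i \in I -> mu i \in C.
  by move=> iI; have := mu_r _ iI; rewrite crossI // => /edge_I; apply.
have hM : hall cross (mu @: I).
  apply/hallP=> Z ZM; pose Y := [set i in I | mu i \in Z].
  have -> : Z = mu @: Y.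
    apply/setP=> z; apply/idP/imsetP=> [zZ|[i]]; last by rewrite inE => /andP[_ h] ->.
    have /imsetP[i iI zE] := subsetP ZM _ zZ; exists i => //.
    by rewrite inE iI -zE.
  apply: leq_trans (leq_imset_card _ _) (subset_leq_card _); apply/subsetP=> i iY.
  apply/nbhdP; exists (mu i); first exact: imset_f.
  by move: iY; rewrite inE => /andP[iI _]; rewrite cross_sym mu_r.
have hA : hall cross (~: A).
  apply/hallP=> Z ZA; apply/subset_leq_card/subsetP=> z zZ; apply/nbhdP; exists z => //.
  by have := subsetP ZA z zZ; rewrite inE /cross => ->; rewrite eqxx orbT.
have nI : nbhd cross I \subset C.
  by apply/subsetP=> z /nbhdP[u uI]; rewrite crossI // => /edge_I; apply.
have MC : mu @: I \subset C by apply/subsetP=> _ /imsetP[i iI ->]; apply: muC.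
have nM : nbhd cross (mu @: I) \subset I by apply: nbhd_crossC.
have nA : nbhd cross (~: A) \subset ~: A.
  apply/subsetP=> z /nbhdP[u]; rewrite !inE /cross !inE => uA.
  rewrite (negPf uA) (contraNF (subsetP sub_I u) uA) !andbF /= => /andP[/eqP <- //].
exists (I :|: mu @: I :|: ~: A).
  apply: hall_union => //; first apply: hall_union hall_I hM _.
    apply: disjointW nI nM _; rewrite -setI_eq0; apply/eqP/setP=> x; rewrite !inE.
    by case: (x \in I); rewrite ?andbF.
  rewrite nbhdU; apply: disjointWr nA _; rewrite disjoints_subset setCK.
  by rewrite subUset (subset_trans nI sub_C) (subset_trans nM sub_I).
have c1 : #|I :|: mu @: I| = 2 * #|I|.
  rewrite cardsU (card_in_imset mu_inj) (_ : I :&: _ = set0) ?cards0; first by lia.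
  apply/setP=> x; rewrite !inE; case xM: (x \in mu @: I); rewrite ?andbF //.
  by rewrite (notin_I (subsetP MC _ xM)).
have sA : I :|: mu @: I \subset A by rewrite subUset sub_I (subset_trans MC sub_C).
have := subset_leq_card sA; rewrite c1 => le1; split=> //.
have : #|(I :|: mu @: I) :|: ~: A| = #|I :|: mu @: I| + #|~: A|.
  by apply: card_disjointU; rewrite disjoints_subset setCK.
by have := cardsC A; rewrite c1; lia.
Qed.

(** No edge of a witness of f joins I to C, so its part in C has fewer neighbours in I
    than elements.  Without an end of f this part is independent, hence satisfies
    Hall's condition.  And it contains no edge but f, as [pair_bound] requires. *)
Lemma outer_edges_bound : #|outer_edges| <= (#|A| - 2 * #|I|) ^ 2.
Proof.
have [Z0 hZ0 [<- _]] := hall_double.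
have /fin_all_exists[J hJ] : forall f : V * V, exists J, f \in outer_edges ->
    near_indep A f.1 f.2 J /\ #|I| < #|J|.
  move=> f; have [|_] := boolP (f \in outer_edges); last by exists set0.
  by rewrite inE => /and4P[_ _ /crit[J nJ lJ] _]; exists J.
apply: (pair_bound (T := fun f => J f :&: C) hZ0) => [f fF|f g fF gF].
  have [nJ ltJ] := hJ f fF; have [JA xJ yJ eJ] := nJ.
  have := fF; rewrite inE => /and4P[xC yC exy _].
  split; last first.
  - have := near_indep_nbhd nJ ltJ; rewrite [X in _ + #|pred_of_set X|](_ : _ = set0) ?cards0 ?addn0 //.
    apply/setP=> i; rewrite in_set0 inE; apply/negP=> /andP[iJ /nbhdP[z]].
    rewrite inE => /andP[zJ zC]; rewrite crossC // => /andP[iI ezi].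
    by case: (eJ z i zJ iJ ezi) => -[_ iE]; rewrite iE notin_I in iI.
  - apply: hall_indep; first by rewrite (subset_trans (subsetDl _ _)) ?subsetIr.
    apply/indepP=> u v; rewrite !inE => /and3P[u2 uJ _] /and3P[v2 vJ _]; apply/negP.
    by case/(eJ u v uJ vJ)=> -[uE vE]; [rewrite vE eqxx in v2|rewrite uE eqxx in u2].
  apply: hall_indep; first by rewrite (subset_trans (subsetDl _ _)) ?subsetIr.
  apply/indepP=> u v; rewrite !inE => /and3P[u2 uJ _] /and3P[v2 vJ _]; apply/negP.
  by case/(eJ u v uJ vJ)=> -[uE vE]; [rewrite uE eqxx in u2|rewrite vE eqxx in v2].
have [[_ _ _ eJ] _] := hJ f fF.
rewrite !inE => /andP[/andP[gJ1 _] /andP[gJ2 _]].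
move: gF fF; rewrite !inE => /and4P[_ _ eg g12] /and4P[_ _ _ f12].
case: f g {hJ} eJ gJ1 gJ2 eg g12 f12 => [a b] [c d] /= eJ gJ1 gJ2 eg g12 f12.
case: (eJ c d gJ1 gJ2 eg) => // -[cE dE]; rewrite cE dE in g12.
by have := ltn_trans g12 f12; rewrite ltnn.
Qed.

Hypothesis deg3 : forall i, i \in I -> 2 < #|nbhd e [set i]|.

(** A set O of edges inside C encodes the choice of one end of each: the first end for
    the edges in O, the second one for the others.  Deleting these ends leaves the
    independent set [CO O].  For the witness J of an edge ic, the set J :&: C is
    independent, so it lies in [CO O] for a suitable O; the witness makes it tight
    and c the only neighbour of i in it, whence ic is forced in the matching O. *)
Theorem critical_bound :
  #|I| <= (2 ^ #|outer_edges|) ^ 3 * (2 * #|outer_edges|) ^ 3.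
Proof.
set m := #|outer_edges|.
pose el (j : 'I_m) : V * V := enum_val j.
have elC j : el j \in outer_edges by apply: enum_valP.
pose K (O : {set 'I_m}) := [set (if j \in O then (el j).1 else (el j).2) | j : 'I_m].
have cardK O : #|K O| <= m by apply: leq_trans (leq_imset_card _ _) _; rewrite card_ord.
pose CO O := C :\: K O.
have COC O : CO O \subset C by apply: subsetDl.
have inCO O x : (x \in CO O) = (x \notin K O) && (x \in C) by rewrite in_setD.
have hCO O : hall cross (CO O).
  apply: hall_indep => //; apply/indepP=> x y; rewrite !inCO => /andP[xK xC] /andP[yK yC].
  apply/negP=> exy.
  wlog lt : x y xK xC yK yC exy / enum_rank x < enum_rank y.
    move=> W; have [h|h|/val_inj/enum_rank_inj xy] := ltngtP (enum_rank x) (enum_rank y).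
    - exact: (W x y).
    - by apply: (W y x); rewrite // e_sym.
    - by rewrite xy e_irr in exy.
  have pF : (x, y) \in outer_edges by rewrite inE xC yC exy.
  pose j : 'I_m := enum_rank_in pF (x, y).
  have elj : el j = (x, y) by rewrite /el enum_rankK_in.
  have : (if j \in O then (el j).1 else (el j).2) \in K O by apply: imset_f.
  by rewrite elj; case: ifP => _ /=; apply/negP.
have /fin_all_exists[f hf] := fun O => hall_matching (hCO O).
have f_inj O : {in CO O &, injective (f O)} by case: (hf O).
have f_rel O c : c \in CO O -> cross c (f O c) by case: (hf O) => _; apply.
have f_I O c : c \in CO O -> f O c \in I.
  by move=> cO; have := f_rel O c cO; rewrite crossC ?(subsetP (COC O)) // => /andP[].
have <- : #|{set 'I_m}| = 2 ^ m by rewrite -cardsT -powersetT card_powerset cardsT card_ord.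
apply: (chain_bound (r := cross) (C := CO) f_inj f_rel f_I) => [O O'|i iI].
  (* A path ends where the first matching misses i, or its partner is not in CO O'. *)
  have : ends I CO f O O' \subset (I :\: f O @: CO O) :|: f O @: (CO O :&: K O').
    apply/subsetP=> t; rewrite !inE => /andP[tI nst].
    rewrite tI andbT; have [/imsetP[c cO tE]|//] := boolP (t \in f O @: CO O).
    apply/imsetP; exists c => //; rewrite in_setI cO; apply: contraNT nst => cK.
    apply/existsP; exists (f O' c); apply/(stepP _ _ _ _); exists c.
    by split=> //; rewrite inCO cK (subsetP (COC O)).
  move/subset_leq_card => h; apply: leq_trans h _; apply: leq_trans (leq_card_setU _ _).1 _.
  have s1 : f O @: CO O \subset I by apply/subsetP=> _ /imsetP[c cO ->]; apply: f_I.
  have := cardsID (f O @: CO O) I; rewrite (setIidPr s1) (card_in_imset (f_inj O)).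
  have := leq_imset_card (f O) (CO O :&: K O').
  have := subset_leq_card (subsetIr (CO O) (K O')); have := cardK O'; have := cardK O.
  have := cardsID (K O) C; rewrite -/(CO O).
  have := subset_leq_card (subsetIr C (K O)).
  have [_ _ [_]] := hall_double; have := cardsID I A; rewrite (setIidPr sub_I) -/C.
  lia.
have F c : e i c -> exists O, forced cross CO f O i c.
  move=> eic; have cC := edge_I iI eic.
  have [J nJ ltJ] := crit eic; have [JA iJ cJ eJ] := nJ.
  have iC : i \in C = false by rewrite inE iI.
  pose Z := J :&: C; have cZ : c \in Z by rewrite inE cJ.
  pose O := [set j | (el j).1 \notin Z].
  have eZ z : z \in Z -> e z i -> z = c.
    rewrite inE => /andP[zJ zC] ezi; case: (eJ z i zJ iJ ezi) => -[zE //].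
    by rewrite zE iC in zC.
  have ZO : Z \subset CO O.
    apply/subsetP=> z zZ; have /setIP[zJ zC] := zZ; rewrite inCO zC andbT.
    apply/imsetP=> -[j _]; have := elC j; rewrite inE => /and4P[_ _ ej _].
    rewrite in_set; case: ifP => [jZ zE|/negbFE zj zE]; first by rewrite -zE zZ in jZ.
    have /setIP[uJ uC] := zj.
    case: (eJ _ _ uJ _ ej) => [|[uE _]|[_ vE]]; first by rewrite -zE.
      by rewrite uE iC in uC.
    by rewrite zE vE iC in zC.
  have rZ : nbhd cross Z \subset f O @: Z.
    have sub : f O @: Z \subset nbhd cross Z.
      apply/subsetP=> _ /imsetP[z zZ ->]; apply/nbhdP; exists z => //.
      by apply: f_rel; apply: (subsetP ZO).
    suff /eqP -> : f O @: Z == nbhd cross Z by [].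
    rewrite eqEcard sub card_in_imset; last first.
      by move=> z z' zZ z'Z; apply: f_inj; apply: (subsetP ZO).
    have := near_indep_nbhd nJ ltJ; rewrite -/Z => h.
    suff : #|J :&: nbhd cross Z| <= #|[set i]| by rewrite cards1 => h1; move: h; lia.
    apply/subset_leq_card/subsetP=> u; rewrite !inE => /andP[uJ /existsP[z /andP[zZ]]].
    have /setIP[zJ zC] := zZ; rewrite crossC // => /andP[uI ezu].
    by case: (eJ z u zJ uJ ezu) => -[zi ui]; [rewrite zi iC in zC|rewrite ui].
  exists O; split; first exact: (subsetP ZO).
    have /(subsetP rZ)/imsetP[z zZ iE] : i \in nbhd cross Z.
      by apply/nbhdP; exists c; rewrite // crossC // iI e_sym.
    rewrite iE; congr (f O _); apply/esym/eZ => //.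
    have := f_rel O z (subsetP ZO _ zZ); rewrite -iE crossC ?(subsetP (COC O)) ?(subsetP ZO) //.
    by case/andP.
  exists Z; split=> //; first by rewrite /tight ZO rZ.
  apply/nbhdP=> -[z]; rewrite in_setD1 => /andP[zc zZ].
  rewrite crossC ?(subsetP (COC O)) ?(subsetP ZO) // => /andP[_ /(eZ z zZ) zE].
  by rewrite zE eqxx in zc.
have ed c : c \in nbhd e [set i] -> e i c by case/nbhdP=> u; rewrite inE => /eqP->.
have /card_gt2P[c1 [c2 [c3 [[/ed h1 /ed h2 /ed h3] [c12 c23 c31]]]]] := deg3 iI.
have [p1 F1] := F c1 h1; have [p2 F2] := F c2 h2; have [p3 F3] := F c3 h3.
exists c1, c2, c3, p1, p2, p3; split=> //=.
by rewrite !inE negb_or c12 c23 eq_sym c31.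
Qed.
End Critical.

(** * Small transversals of maximum independent sets *)

Lemma subset_of_card (V : finType) (A : {set V}) m :
  m <= #|A| -> exists2 B : {set V}, B \subset A & #|B| = m.
Proof.
move=> mA; exists [set x in take m (enum A)].
  by apply/subsetP=> x; rewrite inE => /mem_take; rewrite mem_enum.
rewrite cardsE (card_uniqP (take_uniq _ (enum_uniq _))) size_take -cardE.
by case: ltngtP mA => // ->.
Qed.

Section Indepno.
Variables (V : finType).
Implicit Types (e : rel V) (A B S J : {set V}).

Definition indepno e A := \max_(B : {set V} | (B \subset A) && indep e B) #|B|.

Lemma indep0 e : indep e set0.
Proof. by apply/indepP=> x; rewrite inE. Qed.

Lemma indepno_max e A B : B \subset A -> indep e B -> #|B| <= indepno e A.
Proof. by move=> BA iB; rewrite /indepno (bigmax_sup B) ?BA. Qed.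

Lemma indepno_ex e A : exists2 B : {set V}, (B \subset A) && indep e B & #|B| = indepno e A.
Proof.
have P0 : (set0 \subset A) && indep e set0 by rewrite sub0set indep0.
rewrite /indepno (bigmax_eq_arg set0) //; case: arg_maxnP => // B PB _; by exists B.
Qed.

Lemma indepnoS e A B : A \subset B -> indepno e A <= indepno e B.
Proof.
move=> AB; have [X /andP[XA iX] <-] := indepno_ex e A.
by apply: indepno_max => //; apply: subset_trans AB.
Qed.

Lemma indepno_card e A : indepno e A <= #|A|.
Proof. by have [X /andP[XA _] <-] := indepno_ex e A; apply: subset_leq_card. Qed.

Lemma indepno_sub e e' A : subrel e' e -> indepno e A <= indepno e' A.
Proof.
move=> sub; have [X /andP[XA /indepP iX] <-] := indepno_ex e A.
apply: indepno_max => //; apply/indepP=> x y xX yX.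
by apply: contra (iX x y xX yX); apply: sub.
Qed.

Lemma indepnoD e A S : indepno e A <= indepno e (A :\: S) + #|S|.
Proof.
have [X /andP[XA iX] <-] := indepno_ex e A.
rewrite -(cardsID S X) addnC leq_add //.
  by apply: indepno_max; [apply: setSD|apply: indepS iX; apply: subsetDl].
by rewrite subset_leq_card ?subsetIr.
Qed.

(** The edges of a minimal set D such that every subset of A with more than
    [indepno e A] vertices contains an edge of D: by minimality, each edge is the only
    one of D inside some large set, and that set is its witness. *)
Lemma critical_subgraph e A : symmetric e -> irreflexive e ->
  exists e' : rel V, [/\ subrel e' e, symmetric e', indepno e' A = indepno e A
    & forall x y, e' x y -> exists2 J, near_indep e' A x y J & indepno e A < #|J|].
Proof.
move=> es ei; set a := indepno e A.
pose blocks (D : {set V * V}) :=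
  (D \subset [set p | e p.1 p.2]) &&
  [forall J : {set V}, (J \subset A) && (a < #|J|) ==>
     [exists p in D, (p.1 \in J) && (p.2 \in J)]].
have blocksE : blocks [set p | e p.1 p.2].
  apply/andP; split=> //; apply/forallP=> J; apply/implyP=> /andP[JA lJ].
  have : ~~ indep e J by apply: contraL lJ => iJ; rewrite -leqNgt indepno_max.
  rewrite negb_forall => /existsP[x]; rewrite negb_imply negb_forall => /andP[xJ /existsP[y]].
  rewrite negb_imply negbK => /andP[yJ exy]; apply/existsP; exists (x, y).
  by rewrite inE exy xJ.
have [D /minsetP[/andP[/subsetP DE /forallP bD] minD] _] := minset_exists blocksE.
pose e' : rel V := fun x y => ((x, y) \in D) || ((y, x) \in D).
have sub : subrel e' e.
  by move=> x y /orP[] /DE; rewrite inE //= es.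
have e's : symmetric e' by move=> x y; rewrite /e' orbC.
have key x y : (x, y) \in D -> exists2 J, near_indep e' A x y J & a < #|J|.
  move=> xyD; have: ~~ blocks (D :\ (x, y)).
    apply/negP=> b; have := minD _ b (subsetDl _ _) => E.
    by move: xyD; rewrite -E !inE eqxx.
  rewrite /blocks negb_and; have -> /= : D :\ (x, y) \subset [set p | e p.1 p.2].
    by apply: subset_trans (subsetDl _ _) _; apply/subsetP.
  rewrite negb_forall => /existsP[J]; rewrite negb_imply => /andP[/andP[JA lJ]].
  rewrite negb_exists => /forallP nD; exists J => //.
  have only p : p \in D -> p.1 \in J -> p.2 \in J -> p = (x, y).
    move=> pD p1 p2; apply/eqP; apply: contraNT (nD p) => pxy.
    by rewrite !inE pxy pD p1 p2.
  have /implyP := bD J; rewrite JA lJ => /(_ isT)/existsP[p /and3P[pD p1 p2]].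
  have pE := only p pD p1 p2; rewrite pE in p1 p2; split=> // u v uJ vJ.
  by case/orP=> /only h; [left; apply: h|right; have [-> ->] := h vJ uJ].
exists e'; split=> //; last first.
  move=> x y /orP[/key //|/key[J [JA yJ xJ eJ] lJ]].
  by exists J => //; split=> // u v uJ vJ /(eJ u v uJ vJ)[]; [right|left].
apply/eqP; rewrite eqn_leq (indepno_sub A sub) andbT leqNgt; apply/negP=> lt.
have [J /andP[JA iJ] JE] := indepno_ex e' A; rewrite -JE in lt.
have /implyP := bD J; rewrite JA lt => /(_ isT)/existsP[p /and3P[pD p1 p2]].
by have /indepP/(_ p.1 p.2 p1 p2)/negP := iJ; apply; rewrite /e' -surjective_pairing pD.
Qed.

(** Twice the bound on #|I| given by [critical_bound] for at most d ^ 2 edges inside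
    C, plus the excess d. *)
Definition core_bound d := 2 * ((2 ^ (d ^ 2)) ^ 3 * (2 * d ^ 2) ^ 3) + d.

Lemma small_transversal e A d : symmetric e -> irreflexive e ->
  #|A| <= 2 * indepno e A + d -> core_bound d < #|A| ->
  exists S : {set V}, [/\ S \subset A, #|S| <= 3 & indepno e (A :\: S) < indepno e A].
Proof.
move=> es ei leA gtA.
have [e' [sub e's eqa crit]] := critical_subgraph A es ei.
have e'i : irreflexive e' by move=> x; apply: contraFF (ei x); apply: sub.
have [I /andP[IA iI] IE] := indepno_ex e' A.
have maxI : max_indep e' A I by split=> // J JA iJ; rewrite IE indepno_max.
rewrite -eqa -IE in crit.
have [/exists_inP[v vI dv]|] := boolP [exists v in I, #|nbhd e' [set v]| <= 2].
  pose S := v |: nbhd e' [set v].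
  have vA := subsetP IA v vI.
  have nv u : (u \in nbhd e' [set v]) = e' v u.
    by apply/nbhdP/idP=> [[w]|h]; [rewrite inE => /eqP->|exists v; rewrite ?inE].
  have SA : S \subset A.
    rewrite subUset sub1set vA; apply/subsetP=> u; rewrite nv => /crit[J [JA _ uJ _] _].
    exact: (subsetP JA).
  exists S; split=> //.
    by rewrite cardsU1; case: (_ \notin _) => /=; lia.
  apply: leq_ltn_trans (indepno_sub _ sub) _; rewrite -eqa.
  have [B /andP[BA /indepP iB] <-] := indepno_ex e' (A :\: S).
  have vB : v \notin B by apply/negP=> /(subsetP BA); rewrite !inE eqxx.
  have nb u : u \in B -> ~~ e' v u.
    by move=> /(subsetP BA); rewrite -nv !inE negb_or => /andP[/andP[_]].
  have -> : #|B|.+1 = #|v |: B| by rewrite cardsU1 vB.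
  apply: indepno_max; first by rewrite subUset sub1set vA (subset_trans BA) ?subsetDl.
  apply/indepP=> x y; rewrite !in_setU1 => /predU1P[->|xB] /predU1P[->|yB].
  - by rewrite e'i.
  - exact: nb.
  - by rewrite e's nb.
  - exact: iB.
rewrite negb_exists => /forallP hdeg.
have deg i : i \in I -> 2 < #|nbhd e' [set i]|.
  by move=> iI'; move: (hdeg i); rewrite iI' -ltnNge.
have noiso x : x \in I -> exists y, e' x y.
  move=> /deg h; have /card_gt0P[y /nbhdP[u]] : 0 < #|nbhd e' [set x]| by apply: leq_ltn_trans h.
  by rewrite inE => /eqP -> ?; exists y.
have b1 := critical_bound e's e'i maxI crit noiso deg.
have b2 := outer_edges_bound e's maxI crit noiso.
have [_ _ [_ b3]] := hall_double e's maxI crit noiso.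
set m := #|outer_edges _ _ _| in b1 b2.
have dl : #|A| - 2 * #|I| <= d by rewrite IE eqa; lia.
have mb : m <= d ^ 2 by apply: leq_trans b2 _; rewrite leq_exp2r.
have Ib : #|I| <= (2 ^ (d ^ 2)) ^ 3 * (2 * d ^ 2) ^ 3.
  by apply: leq_trans b1 _; rewrite leq_mul // leq_exp2r ?leq_exp2l // leq_mul.
have : #|A| <= core_bound d by rewrite /core_bound; lia.
by rewrite leqNgt gtA.
Qed.

Lemma indepno_pad e A m : m + indepno e A <= #|A| ->
  exists B : {set V}, [/\ B \subset A, #|B| + m = #|A| & indepno e B = indepno e A].
Proof.
elim: m => [|m IH] h; first by exists A; rewrite addn0.
have [|B [BA cB eB]] := IH; first by lia.
have [J /andP[JB iJ] JE] := indepno_ex e B.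
have /card_gt0P[x] : 0 < #|B :\: J| by have := cardsID J B; rewrite (setIidPr JB) JE eB; lia.
rewrite inE => /andP[xJ xB]; exists (B :\ x); split.
- by apply: subset_trans BA; apply: subsetDl.
- by have := cardsD1 x B; rewrite xB; lia.
rewrite -eB; apply/eqP; rewrite eqn_leq indepnoS ?subsetDl //= -JE indepno_max //.
by apply/subsetP=> y yJ; rewrite !inE (subsetP JB) // andbT; apply: contraNneq xJ => <-.
Qed.

(** Removing exactly three vertices for a loss of exactly one does not increase
    the excess, so the argument can be repeated with the same d.  A minimal
    transversal loses exactly one, and vertices outside a maximum independent set
    fill it up to three. *)
Lemma exact_transversal e A d : symmetric e -> irreflexive e ->
  #|A| <= 2 * indepno e A + d -> core_bound d < #|A| -> indepno e A + 3 <= #|A| ->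
  exists B : {set V}, [/\ B \subset A, #|B| + 3 = #|A| & indepno e B + 1 = indepno e A].
Proof.
move=> es ei leA gtA ltA.
have [S0 [S0A cS0 ltS0]] := small_transversal es ei leA gtA.
have [S /minsetP[ltS minS] SS0] :=
  minset_exists (P := fun S : {set V} => indepno e (A :\: S) < indepno e A) ltS0.
have cS : #|S| <= 3 by apply: leq_trans cS0; apply: subset_leq_card.
have SA := subset_trans SS0 S0A.
have [x xS] : exists x, x \in S.
  by apply/set0Pn/eqP=> S0'; move: ltS; rewrite S0' setD0 ltnn.
have eS : indepno e (A :\: S) + 1 = indepno e A.
  have : ~~ (indepno e (A :\: (S :\ x)) < indepno e A).
    by apply/negP=> h; have E := minS _ h (subsetDl _ _); move: xS; rewrite -E !inE eqxx.
  have := indepnoD e (A :\: (S :\ x)) [set x]; rewrite cards1 setDDl setUC setD1K //.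
  lia.
have cAS : #|A :\: S| + #|S| = #|A| by have := cardsID S A; rewrite (setIidPr SA); lia.
have [|B [BA cB eB]] := @indepno_pad e (A :\: S) (3 - #|S|); first by lia.
exists B; split; [by apply: subset_trans BA (subsetDl _ _)|lia|lia].
Qed.

Lemma repeated_transversal e d j A : symmetric e -> irreflexive e ->
  #|A| <= 2 * indepno e A + d -> core_bound d + 3 * j < #|A| -> 
  exists B : {set V}, [/\ B \subset A, #|A| <= #|B| + 3 * j & indepno e B + j <= indepno e A].
Proof.
move=> es ei; elim: j A => [|j IH] A leA gtA; first by exists A; rewrite !addn0.
have [ltA|geA] := leqP (indepno e A + 3) #|A|.
  have [|B [BA cB eB]] := exact_transversal es ei leA _ ltA; first by lia.
  have [||D [DB cD eD]] := IH B; [by lia|by lia|].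
  by exists D; split; [apply: subset_trans BA|lia|lia].
(* Almost no vertex lies outside a maximum independent set: any j + 3 vertices do. *)
have [D DA cD] := @subset_of_card _ A (#|A| - (j + 3)) (leq_subr _ _).
exists D; split=> //; first by rewrite cD; lia.
by have := indepno_card e D; rewrite cD; lia.
Qed.
End Indepno.

Section Transfer.
Variable G : sgraph.

Lemma alpha_indepno : alpha G = indepno (@edge G) [set: G].
Proof. by apply: eq_bigl => B; rewrite subsetT. Qed.

Lemma alpha_del (S : {set G}) : alpha (del_vertices S) <= indepno (@edge G) (~: S).
Proof.
apply/bigmax_leqP=> B iB; rewrite -(card_imset _ val_inj); apply: indepno_max.
  by apply/subsetP=> _ /imsetP[x _ ->]; rewrite inE (valP x).
apply/indepP=> _ _ /imsetP[x xB ->] /imsetP[y yB ->].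
by move/forall_inP/(_ x xB)/forall_inP/(_ y yB): iB.
Qed.

End Transfer.

Lemma core_bound_exponential d j : 3 <= d -> 3 * j <= 3 * d ->
  core_bound d + 3 * j <= 2 ^ (3 * (d + 1) ^ 2).
Proof.
move=> d3 jd; rewrite /core_bound.
have lt2 n : n < 2 ^ n by apply: ltn_expl.
have E1 : (2 ^ (d ^ 2)) ^ 3 = 2 ^ (3 * d ^ 2) by rewrite -expnM mulnC.
have E2 : (2 * d ^ 2) ^ 3 <= 2 ^ (3 * (d + 2)).
  rewrite (mulnC 3) expnM leq_exp2r // [d + 2]addnS (expnS 2) leq_mul //.
  elim: d d3 {jd lt2 E1} => // d IH; rewrite leq_eqVlt => /orP[/eqP <- //|d3].
  by rewrite addSn (expnS 2); apply: leq_trans (leq_mul (leqnn 2) (IH d3)); rewrite -!mulnn; nia.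
have E3 : d + 3 * j <= 2 ^ (d + 2).
  by rewrite expnD; have := lt2 d; lia.
rewrite E1 -addnA.
have E4 : 2 * (2 ^ (3 * d ^ 2) * (2 * d ^ 2) ^ 3) <= 2 ^ (3 * d ^ 2 + 3 * d + 7).
  apply: leq_trans (_ : 2 * (2 ^ (3 * d ^ 2) * 2 ^ (3 * (d + 2))) <= _).
    by do 2!apply: leq_mul => //.
  by rewrite -expnD -expnS leq_exp2l //; lia.
apply: leq_trans (leq_add E4 E3) _.
apply: leq_trans (_ : 2 ^ (3 * d ^ 2 + 6 * d + 2) + 2 ^ (3 * d ^ 2 + 6 * d + 2) <= _).
  by apply: leq_add; rewrite leq_exp2l //; lia.
by rewrite addnn -mul2n -expnS leq_exp2l //; rewrite sqrnD; lia.
Qed.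

Theorem theorem1p5 (k l q : nat) (hk : 3 * l + 3 <= k) (G : sgraph)
  (hG : tight_stable q k l G) :
  #|G| <= (k - 3 * l - 3) + 2 ^ (3 * (l + 2 * q + 4) ^ 2).
Proof.
case: hG => st tg; rewrite leqNgt; apply/negP=> big.
set e := @edge G; have es : symmetric e := @edge_sym G.
have ei : irreflexive e := @edge_irrefl G.
have leG : alpha G <= #|G| by rewrite alpha_indepno -[X in _ <= X]cardsT indepno_card.
have lowG : 2 * alpha G + 2 * q + k <= #|G| + 2 * l + 1 by lia.
have highG : #|G| + 2 * l <= 2 * alpha G + 2 * q + k by lia.
have [|A [_ cA eA]] := @indepno_pad G e [set: G] (k - 3 * l - 3).
  by rewrite cardsT -alpha_indepno; lia.
rewrite cardsT in cA; rewrite -alpha_indepno in eA.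
pose d := l + 2 * q + 3.
have cb : core_bound d + 3 * l.+1 <= 2 ^ (3 * (l + 2 * q + 4) ^ 2).
  rewrite (_ : l + 2 * q + 4 = d + 1); last by rewrite /d; lia.
  by apply: core_bound_exponential; rewrite /d; lia.
have [||B [BA cB eB]] := @repeated_transversal G e d l.+1 A es ei.
- by rewrite eA /d; lia.
- by apply: leq_ltn_trans cb _; lia.
have [|S0 S0S cS] := @subset_of_card G B (#|G| - k).
  by lia.
have cS' : #|~: S0| = k by have := cardsC S0; rewrite cS; lia.
have := leq_trans (st _ cS') (alpha_del _); rewrite setCK -/e => h.
by have := indepnoS e S0S; lia.
Qed.
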